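(* Let $f(x)=x^4+c_3x^3+c_2x^2+c_1x+c_0$ be a monic polynomial of degree $4$ with integer coefficients. Then $f(x)$ is a Cappell-Shaneson polynomial if and only if there is an integer $a$ such that $(c_0,c_1,c_2,c_3)$ equals one of the following: (1) $(1,\ a-1,\ -2a,\ a)$; (2) $(1,\ a-1,\ -2a-2,\ a)$; (3) $(1,\ a+1,\ -2a-2,\ a)$; (4) $(1,\ a+1,\ -2a-4,\ a)$. Further, the polynomial $f(x)$ given by (1), (2), (3), (4) with parameter $a$ is positive if and only if, respectively, $a\le 0$; $a\le 0$; $a\le -1$; $a\le -1$.
   Context: For $n\ge 2$, a matrix $A\in\mathrm{SL}(n,\mathbb{Z})$ is a Cappell-Shaneson matrix of order $n$ if for every $k\in\{1,\ldots,[n/2]\}$ one has $\det(I-\bigwedge^kA)\in\{1,-1\}$, where $\bigwedge^k A$ is the $k$-th exterior power of $A$ and $I$ is the identity matrix. A monic integer polynomial of degree $n$ is a Cappell-Shaneson polynomial of degree $n$ if it is the characteristic polynomial of some Cappell-Shaneson matrix of order $n$. A Cappell-Shaneson polynomial $f$ of degree $n$ is positive if $(-1)^nf(t)>0$ for every real $t<0$. *)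

(* Defs.v *)
From mathcomp Require Import all_boot all_order all_algebra.
From mathcomp Require Import reals.
Set Implicit Arguments.
Unset Strict Implicit.
Unset Printing Implicit Defensive.
Import Order.TTheory GRing.Theory Num.Theory.
Local Open Scope ring_scope.

(* [ext_index n k] indexes the standard basis of the k-th exterior power of
   R^n: f stands for e_(f 0) /\ ... /\ e_(f (k-1)), f 0 < ... < f (k-1). *)
Definition ext_index (n k : nat) : finType :=
  {f : {ffun 'I_k -> 'I_n} |
     [forall i : 'I_k, forall j : 'I_k, (i < j)%N ==> (f i < f j)%N]}.

(* Matrix of the k-th exterior power of A in that basis: applying A to each
   factor of a basis vector and expanding by multilinearity and alternation,
   the (f, g) coefficient is the minor of A on rows f and columns g. *)
Definition exterior_power (R : comNzRingType) (n k : nat) (A : 'M[R]_n) :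
    'M[R]_#|ext_index n k| :=
  \matrix_(p < #|ext_index n k|, q < #|ext_index n k|)
     \det (mxsub (val (enum_val p)) (val (enum_val q)) A).

Definition CS_matrix (n : nat) (A : 'M[int]_n) : Prop :=
  [/\ (2 <= n)%N, \det A = 1
    & forall k : nat, (1 <= k <= n./2)%N ->
        \det (1%:M - exterior_power k A) = 1 \/
        \det (1%:M - exterior_power k A) = -1].

Definition CS_poly (n : nat) (f : {poly int}) : Prop :=
  [/\ f \is monic, size f = n.+1
    & exists2 A : 'M[int]_n, CS_matrix A & f = char_poly A].

Definition positive_CS_poly (R : realType) (n : nat) (f : {poly int}) : Prop :=
  CS_poly n f /\
  forall t : R, t < 0 -> 0 < (-1) ^+ n * (map_poly intr f).[t].

Definition quartic (c0 c1 c2 c3 : int) : {poly int} :=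
  'X^4 + c3 *: 'X^3 + c2 *: 'X^2 + c1 *: 'X + c0%:P.

(* Main.v *)
Require Import Defs.
From mathcomp Require Import all_boot all_order all_algebra.
From mathcomp Require Import reals.
From mathcomp Require Import perm spectral algC ring lra zify.
Import Order.TTheory GRing.Theory Num.Theory.
Local Open Scope ring_scope.

(* The determinant of I - A is f(1). If A has eigenvalues a, b, c, d with
   a b c d = 1, the eigenvalues of its exterior square are the pairwise
   products, and (1 - a b)(1 - c d) = 2 - (a b + c d), so that the determinant
   of I minus the exterior square is the resolvent cubic of f at 2, which equals
   - (c_1 - c_3)^2. The conditions thus read f(1) = 1 or -1 and
   c_1 - c_3 = 1 or -1.
   For the positivity, f(t) is a fixed quartic plus a t (t - 1)^2; it increases
   for t < 0 as a decreases, is positive there at the largest claimed a, and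
   is nonpositive at t = -1 for the next integer. *)

Local Notation o4 k := (@Ordinal 4 k isT).

(** * Exterior powers in an explicitly listed basis *)

Lemma det_reindex (R : comNzRingType) (T : finType) (n : nat) (h : 'I_n -> T)
    (F : T -> T -> R) : bijective h ->
  \det (\matrix_(p < #|T|, q < #|T|) F (enum_val p) (enum_val q)) =
  \det (\matrix_(i < n, j < n) F (h i) (h j)).
Proof.
move=> bij_h.
(* Identifying [n] with [#|T|] makes [enum_rank] after [h] a permutation of a single index type. *)
have eq_n : n = #|T| by rewrite -(bij_eq_card bij_h) card_ord.
subst n.
have inj_s : injective (fun i => enum_rank (h i)).
  by move=> i j /enum_rank_inj /(bij_inj bij_h).
set M := (M in \det M = _).
have -> : \matrix_(i, j) F (h i) (h j) = row_perm (perm inj_s) (col_perm (perm inj_s) M).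
  by apply/matrixP => i j; rewrite !mxE !permE !enum_rankK.
(* Rows and columns undergo the same permutation, so its sign occurs twice and cancels. *)
rewrite row_permE col_permE !det_mulmx !det_perm odd_permV.
by rewrite mulrCA -signr_addb addbb mulr1.
Qed.

Lemma det_one_sub_exterior_reindex (R : comNzRingType) (n k m : nat)
    (h : 'I_m -> ext_index n k) (A : 'M[R]_n) : bijective h ->
  \det (1%:M - exterior_power k A) =
  \det (1%:M - \matrix_(i < m, j < m) \det (mxsub (val (h i)) (val (h j)) A)).
Proof.
move=> bij_h.
pose F (f g : ext_index n k) := (f == g)%:R - \det (mxsub (val f) (val g) A).
transitivity (\det (\matrix_(p < #|ext_index n k|, q < #|ext_index n k|)
    F (enum_val p) (enum_val q))).
  by congr (\det _); apply/matrixP => p q; rewrite !mxE /F (inj_eq enum_val_inj).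
rewrite (det_reindex _ _ _ _ F bij_h); congr (\det _); apply/matrixP => i j.
by rewrite !mxE /F (inj_eq (bij_inj bij_h)).
Qed.

(* The pairs (pair_fst i, pair_snd i) list the pairs of indices in lexicographic
   order, so that the second compound of a lower triangular matrix is again
   lower triangular. *)
Definition pair_fst (i : 'I_6) : 'I_4 :=
  nth ord0 [:: o4 0; o4 0; o4 0; o4 1; o4 1; o4 2] i.
Definition pair_snd (i : 'I_6) : 'I_4 :=
  nth ord0 [:: o4 1; o4 2; o4 3; o4 2; o4 3; o4 3] i.

Lemma ord2_cases (i : 'I_2) : i = ord0 \/ i = ord_max.
Proof. by case: i => [[|[|//]] i]; [left|right]; apply/val_inj. Qed.

Definition pair_fun (i : 'I_6) : {ffun 'I_2 -> 'I_4} :=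
  [ffun k : 'I_2 => if k == ord0 then pair_fst i else pair_snd i].

Lemma pair_fun_incr (i : 'I_6) :
  [forall k : 'I_2, forall l : 'I_2, (k < l)%N ==> (pair_fun i k < pair_fun i l)%N].
Proof.
apply/forallP => k; apply/forallP => l; apply/implyP; rewrite !ffunE.
by case: (ord2_cases k) (ord2_cases l) => -> [] ->; case: i => -[|[|[|[|[|[|]]]]]].
Qed.

Definition pair_index (i : 'I_6) : ext_index 4 2 :=
  exist _ (pair_fun i) (pair_fun_incr i).

Lemma pair_index_bij : bijective pair_index.
Proof.
have inj : injective pair_index.
  move=> i j /(congr1 val) /= /ffunP e.
  have := e ord0; have := e ord_max; rewrite !ffunE /= => /(congr1 val) + /(congr1 val).
  by case: i {e} => -[|[|[|[|[|[|//]]]]]] ?;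
     case: j => -[|[|[|[|[|[|//]]]]]] ? //= _ _; apply/val_inj.
(* The inverse searches for a preimage; the default [ord0] is never reached, since every increasing
   pair is listed. *)
pose rank (f : ext_index 4 2) : 'I_6 :=
  odflt ord0 [pick i | pair_index i == f].
exists rank => [i | f]; rewrite /rank.
  by case: pickP => [j /eqP /inj // | /(_ i)]; rewrite eqxx.
case: pickP => [j /eqP // | no]; exfalso.
case: f no => f Pf no.
have lt01 : (f ord0 < f ord_max)%N.
  by move/forallP: (Pf) => /(_ ord0) /forallP /(_ ord_max).
have: exists i, pair_fst i = f ord0 /\ pair_snd i = f ord_max.
  case: (f ord0) (f ord_max) lt01 => [[|[|[|[|//]]]] ?] [[|[|[|[|//]]]] ?] //= _;
  [exists (@Ordinal 6 0 isT) | exists (@Ordinal 6 1 isT) | exists (@Ordinal 6 2 isT)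
  | exists (@Ordinal 6 3 isT) | exists (@Ordinal 6 4 isT) | exists (@Ordinal 6 5 isT)];
  by split; apply/val_inj.
case=> i [e0 e1]; have /eqP[] := no i.
apply/val_inj/ffunP => k; rewrite /= ffunE.
by case: (ord2_cases k) => ->.
Qed.

(** * The second compound matrix: 2 by 2 minors in the pair basis *)

Definition second_compound {R : comNzRingType} (A : 'M[R]_4) : 'M[R]_6 :=
  \matrix_(r, s) (A (pair_fst r) (pair_fst s) * A (pair_snd r) (pair_snd s)
                - A (pair_fst r) (pair_snd s) * A (pair_snd r) (pair_fst s)).

Lemma det_mx22 (R : comNzRingType) (A : 'M[R]_2) :
  \det A = A ord0 ord0 * A ord_max ord_max - A ord0 ord_max * A ord_max ord0.
Proof.
have e (i : 'I_1) : lift ord0 i = ord_max :> 'I_2 by rewrite ord1; apply/val_inj.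
have e' (i : 'I_1) : lift ord_max i = ord0 :> 'I_2 by rewrite ord1; apply/val_inj.
rewrite (expand_det_row _ ord0) !big_ord_recl big_ord0 /cofactor !det_mx11 !mxE !(e, e').
by rewrite /= !add0n expr0 expr1 addr0 mul1r mulN1r mulrN.
Qed.

Lemma det_one_sub_exterior2 (R : comNzRingType) (A : 'M[R]_4) :
  \det (1%:M - exterior_power 2 A) = \det (1%:M - second_compound A).
Proof.
rewrite (det_one_sub_exterior_reindex _ _ _ _ _ A pair_index_bij).
congr (\det (_ - _)); apply/matrixP => i j.
by rewrite mxE [RHS]mxE det_mx22 !mxE !ffunE.
Qed.

Lemma big_ord4 (T : Type) (idx : T) (op : Monoid.law idx) (F : 'I_4 -> T) :
  \big[op/idx]_(i < 4) F i = op (F (o4 0)) (op (F (o4 1)) (op (F (o4 2)) (F (o4 3)))).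
Proof.
rewrite !big_ord_recl big_ord0 Monoid.mulm1.
by congr (op (F _) (op (F _) (op (F _) (F _)))); apply/val_inj.
Qed.

(** An instance of the Cauchy-Binet formula, small enough to be checked by expanding all entries. *)
Lemma second_compoundM (R : comNzRingType) (A B : 'M[R]_4) :
  second_compound (A *m B) = second_compound A *m second_compound B.
Proof.
apply/matrixP => i j; rewrite !mxE !big_ord4 !big_ord_recl big_ord0 !mxE.
rewrite /pair_fst /pair_snd /=; ring.
Qed.

Lemma second_compound1 (R : comNzRingType) : second_compound (1%:M : 'M[R]_4) = 1%:M.
Proof.
apply/matrixP => i j; rewrite !mxE.
case: i => -[|[|[|[|[|[|//]]]]]] ?; case: j => -[|[|[|[|[|[|//]]]]]] ? //=;
  rewrite ?(mul0r, mulr0, mul1r, subrr, subr0); done.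
Qed.

Lemma second_compound_map (R S : comNzRingType) (f : {rmorphism R -> S}) (A : 'M[R]_4) :
  second_compound (map_mx f A) = map_mx f (second_compound A).
Proof. by apply/matrixP => i j; rewrite !mxE rmorphB !rmorphM. Qed.

(** For rows p < q and columns r < s with (p, q) before (r, s), either p < r, or p = r and q < s. In
    both cases each of the two products in the minor has a factor above the diagonal. *)
Lemma second_compound_trig (R : comNzRingType) (A : 'M[R]_4) :
  is_trig_mx A -> is_trig_mx (second_compound A).
Proof.
move=> /is_trig_mxP trA; apply/is_trig_mxP => i j.
case: i => -[|[|[|[|[|[|//]]]]]] ?; case: j => -[|[|[|[|[|[|//]]]]]] ? //= _;
  rewrite mxE /pair_fst /pair_snd /=;
  do ?[rewrite (trA (o4 0) (o4 1)) // | rewrite (trA (o4 0) (o4 2)) //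
     | rewrite (trA (o4 0) (o4 3)) // | rewrite (trA (o4 1) (o4 2)) //
     | rewrite (trA (o4 1) (o4 3)) // | rewrite (trA (o4 2) (o4 3)) //];
  by rewrite ?(mul0r, mulr0, subrr).
Qed.

(** * Similarity invariance and characteristic polynomials *)

Lemma det_one_sub_second_compound_similar (F : fieldType) (P A B : 'M[F]_4) :
  P \in unitmx -> P *m A = B *m P ->
  \det (1%:M - second_compound A) = \det (1%:M - second_compound B).
Proof.
move=> Pu PA.
(* By multiplicativity the compound of [P] is invertible and intertwines those of [A] and [B]; its
   determinant can then be cancelled. *)
have u : \det (second_compound P) != 0.
  have := congr1 (fun M => \det (second_compound M)) (mulmxV Pu).
  rewrite second_compoundM second_compound1 det_mulmx det1 => e.
  by apply/eqP => z; move/eqP: e; rewrite z mul0r eq_sym oner_eq0.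
apply: (mulfI u); rewrite -det_mulmx mulrC -det_mulmx mulmxBr mulmxBl.
by rewrite -!second_compoundM PA mulmx1 mul1mx.
Qed.

Lemma char_poly_similar (F : fieldType) (n : nat) (P A B : 'M[F]_n) :
  P \in unitmx -> P *m A = B *m P -> char_poly A = char_poly B.
Proof.
move=> Pu PA.
have u : \det (map_mx polyC P) != 0.
  by rewrite det_map_mx polyC_eq0 -unitfE -unitmxE.
apply: (mulfI u); rewrite /char_poly -det_mulmx mulrC -det_mulmx; congr (\det _).
rewrite /char_poly_mx mulmxBr mulmxBl -!map_mxM PA.
by rewrite mul_mx_scalar mul_scalar_mx.
Qed.

Lemma char_poly_horner1 (R : comNzRingType) (n : nat) (A : 'M[R]_n) :
  (char_poly A).[1] = \det (1%:M - A).
Proof.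
rewrite -horner_evalE /char_poly -det_map_mx; congr (\det _).
apply/matrixP => i j; rewrite !mxE.
by rewrite /= /horner_eval hornerD hornerN hornerC hornerMn hornerX.
Qed.

Lemma coef_quartic_prod (R : comNzRingType) (a b c d : R) :
  let p := ('X - a%:P) * (('X - b%:P) * (('X - c%:P) * ('X - d%:P))) in
  p`_3 = - (a + b + c + d) /\ p`_1 = - (a * b * c + a * b * d + a * c * d + b * c * d).
Proof.
move=> p.
have -> : p = 'X^4 - (a + b + c + d) *: 'X^3
   + (a * b + a * c + a * d + b * c + b * d + c * d) *: 'X^2
   - (a * b * c + a * b * d + a * c * d + b * c * d) *: 'X + (a * b * c * d)%:P.
  rewrite /p -!mul_polyC !(polyCD, polyCM); ring.
by rewrite !coefE /=; split; ring.
Qed.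

(** * The exterior square determinant in terms of the coefficients *)

Lemma det_one_sub_second_compound_trig (R : comNzRingType) (A : 'M[R]_4) :
  is_trig_mx A -> \det A = 1 ->
  \det (1%:M - second_compound A) = - ((char_poly A)`_1 - (char_poly A)`_3) ^+ 2.
Proof.
move=> trA; rewrite det_trig // char_poly_trig // !big_ord4 => detA.
have [-> ->] := coef_quartic_prod _ (A (o4 0) (o4 0)) (A (o4 1) (o4 1))
  (A (o4 2) (o4 2)) (A (o4 3) (o4 3)).
have /is_trig_mxP tr2 := second_compound_trig _ _ trA.
rewrite det_trig; last first.
  apply/is_trig_mxP => i j ij; rewrite mxE [X in _ + X]mxE tr2 // subr0 mxE.
  by rewrite -val_eqE /= ltn_eqF.
have diag (i : 'I_6) : (1%:M - second_compound A) i i =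
    1 - A (pair_fst i) (pair_fst i) * A (pair_snd i) (pair_snd i).
  have lt_i : (pair_fst i < pair_snd i)%N by case: i => -[|[|[|[|[|[|]]]]]].
  by move/is_trig_mxP: trA => trA; rewrite !mxE eqxx (trA _ _ lt_i) mul0r subr0.
rewrite (eq_bigr _ (fun i _ => diag i)) !big_ord_recl big_ord0 /pair_fst /pair_snd /=.
move: detA; move: (A (o4 0) (o4 0)) (A (o4 1) (o4 1)) (A (o4 2) (o4 2)) (A (o4 3) (o4 3)).
(* As abcd = 1, one has 1 - cd = - cd (1 - ab), and likewise for the other complementary pairs. The
   six factors thus multiply to minus the square of bcd (1 - ab)(1 - ac)(1 - ad), which expands to
   (abc + abd + acd + bcd) - (a + b + c + d). *)
move=> a b c d /= abcd; ring: abcd.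
Qed.

(** Schur triangularisation reduces to the triangular case, as both sides are similarity
    invariants. *)
Lemma det_one_sub_second_compound (C : numClosedFieldType) (A : 'M[C]_4) : \det A = 1 ->
  \det (1%:M - second_compound A) = - ((char_poly A)`_1 - (char_poly A)`_3) ^+ 2.
Proof.
have [P /unitarymx_unit Pu trT] := Schur A isT => detA.
have PA : P *m A = conjmx P A *m P by apply/(similarP Pu)/eqP.
rewrite (det_one_sub_second_compound_similar _ _ _ _ Pu PA).
rewrite (char_poly_similar _ _ _ _ _ Pu PA).
apply: det_one_sub_second_compound_trig; first exact: trT.
by rewrite conjumx // !det_mulmx mulrAC -det_mulmx mulmxV // det1 mul1r.
Qed.

Lemma det_one_sub_exterior2_int (A : 'M[int]_4) : \det A = 1 ->
  \det (1%:M - exterior_power 2 A) = - ((char_poly A)`_1 - (char_poly A)`_3) ^+ 2.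
Proof.
(* Eigenvalues need a closed field: the identity is pulled back along the injection of the integers
   into [algC]. *)
move=> detA; rewrite det_one_sub_exterior2; apply: (@intr_inj algC).
rewrite rmorphN rmorphXn rmorphB /=.
rewrite -!(coef_map (intr : {rmorphism int -> algC})) /= map_char_poly.
rewrite -det_map_mx map_mxB map_mx1 -second_compound_map.
by rewrite det_one_sub_second_compound // det_map_mx detA.
Qed.

(** * The first exterior power, which is the matrix itself *)

Lemma singleton_incr (n : nat) (i : 'I_n) :
  [forall k : 'I_1, forall l : 'I_1, (k < l)%N ==>
     ([ffun _ : 'I_1 => i] k < [ffun _ : 'I_1 => i] l)%N].
Proof. by apply/forallP => k; apply/forallP => l; rewrite !ord1. Qed.

Definition singleton_index (n : nat) (i : 'I_n) : ext_index n 1 :=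
  exist _ [ffun _ => i] (singleton_incr n i).

Lemma singleton_index_bij (n : nat) : bijective (singleton_index n).
Proof.
exists (fun f => (val f : {ffun 'I_1 -> 'I_n}) ord0) => [i | f]; first by rewrite ffunE.
by apply/val_inj/ffunP => k; rewrite ffunE [k]ord1.
Qed.

Lemma det_one_sub_exterior1 (R : comNzRingType) (n : nat) (A : 'M[R]_n) :
  \det (1%:M - exterior_power 1 A) = (char_poly A).[1].
Proof.
rewrite (det_one_sub_exterior_reindex _ _ _ _ _ A (singleton_index_bij n)).
rewrite char_poly_horner1; congr (\det (_ - _)); apply/matrixP => i j.
by rewrite mxE det_mx11 mxE !ffunE.
Qed.

(** * Cappell-Shaneson quartics in terms of their coefficients *)

Lemma coef_quartic (c0 c1 c2 c3 : int) :
  [/\ (quartic c0 c1 c2 c3)`_0 = c0, (quartic c0 c1 c2 c3)`_1 = c1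
    & (quartic c0 c1 c2 c3)`_3 = c3].
Proof. by rewrite /quartic !coefE /=; split; ring. Qed.

(** The list ends in 1, so it is already normalised; size and leading coefficient can then be read
    off. *)
Lemma quartic_Poly (c0 c1 c2 c3 : int) :
  quartic c0 c1 c2 c3 = [:: c0; c1; c2; c3; 1] :> seq int.
Proof.
rewrite -(@PolyK _ 0 [:: c0; c1; c2; c3; 1]) //; congr polyseq.
by rewrite /quartic /= !cons_poly_def mul0r add0r -!mul_polyC; ring.
Qed.

Lemma quartic_monic (c0 c1 c2 c3 : int) : quartic c0 c1 c2 c3 \is monic.
Proof. by rewrite monicE lead_coefE quartic_Poly. Qed.

Lemma matrix_of_char_poly (R : comNzRingType) (n : nat) (p : {poly R}) :
  p \is monic -> size p = n.+1 -> exists A : 'M[R]_n, char_poly A = p.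
Proof.
(* The companion matrix has order [(size p).-1], which [sp] turns into [n] afterwards. *)
move=> mp sp; have : exists A : 'M[R]_((size p).-1), char_poly A = p.
  by exists (companionmx p); rewrite companionmxK.
by rewrite sp.
Qed.

(** The criterion sees [A] only through its characteristic polynomial, so any one matrix realising
    the quartic, such as the companion matrix, decides whether it is a Cappell-Shaneson
    polynomial. *)
Lemma CS_matrix4P (A : 'M[int]_4) (c0 c1 c2 c3 : int) :
  quartic c0 c1 c2 c3 = char_poly A ->
  CS_matrix A <-> [/\ c0 = 1, `|1 + c3 + c2 + c1 + c0| = 1 & `|c1 - c3| = 1].
Proof.
move=> e; have [e0 e1 e3] := coef_quartic c0 c1 c2 c3.
have detA : \det A = c0 by rewrite -e0 e char_poly_det -signr_odd /= expr0 mul1r.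
have ev1 : \det (1%:M - exterior_power 1 A) = 1 + c3 + c2 + c1 + c0.
  by rewrite det_one_sub_exterior1 -e /quartic !hornerE /=; ring.
have ev2 : c0 = 1 -> \det (1%:M - exterior_power 2 A) = - (c1 - c3) ^+ 2.
  by move=> c01; rewrite det_one_sub_exterior2_int ?detA // -e e1 e3.
split=> [[_ d k12] | [c01 n1 n2]].
  have c01 : c0 = 1 by rewrite -detA.
  have := k12 1 isT; have := k12 2 isT; rewrite ev1 (ev2 c01) => h2 h1.
  by split=> //; [lia | nia].
(* As [4./2] is 2, only the exterior powers k = 1 and k = 2 remain. *)
split=> // [|[|[|[|k]]] //= _]; first by rewrite detA.
  by rewrite ev1; lia.
by rewrite (ev2 c01); nia.
Qed.

Lemma CS_poly4P (c0 c1 c2 c3 : int) :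
  CS_poly 4 (quartic c0 c1 c2 c3) <->
  [/\ c0 = 1, `|1 + c3 + c2 + c1 + c0| = 1 & `|c1 - c3| = 1].
Proof.
split=> [[_ _ [A csA e]] | h]; first exact/(CS_matrix4P A).
have sz : size (quartic c0 c1 c2 c3) = 5 by rewrite quartic_Poly.
have [A e] := matrix_of_char_poly _ _ _ (quartic_monic c0 c1 c2 c3) sz.
split=> //; first exact: quartic_monic.
by exists A => //; apply/(CS_matrix4P A c0 c1 c2 c3).
Qed.

Lemma CS_poly4_families (c0 c1 c2 c3 : int) :
  CS_poly 4 (quartic c0 c1 c2 c3) <->
    exists a : int,
       [\/ (c0, c1, c2, c3) = (1, a - 1, - 2 * a, a),
           (c0, c1, c2, c3) = (1, a - 1, - 2 * a - 2, a),
           (c0, c1, c2, c3) = (1, a + 1, - 2 * a - 2, a)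
         | (c0, c1, c2, c3) = (1, a + 1, - 2 * a - 4, a)].
Proof.
rewrite CS_poly4P; split=> [[-> n1 n2] | [a]]; last first.
  by case=> -[-> -> -> ->]; split=> //; lia.
(* The parameter is forced to be [c3]. The value f(1) = 1 leads to families (1) and (3), f(1) = -1
   to (2) and (4); the sign of [c1 - c3] separates the two in each case. *)
exists c3.
have : c1 = c3 - 1 \/ c1 = c3 + 1 by lia.
have : 1 + c3 + c2 + c1 + 1 = 1 \/ 1 + c3 + c2 + c1 + 1 = -1 by lia.
case=> e2 [] e1; [apply: Or41 | apply: Or43 | apply: Or42 | apply: Or44];
  by congr (_, _, _, _); lia.
Qed.

(** * Positivity on the negative half-line *)

Lemma horner_quartic (R : realType) (a c1 c2 : int) (t : R) :
  (-1) ^+ 4 * (map_poly intr (quartic 1 c1 c2 a)).[t] =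
  t ^+ 4 + (c2 + 2 * a)%:~R * t ^+ 2 + (c1 - a)%:~R * t + 1 + a%:~R * (t * (t - 1) ^+ 2).
Proof.
rewrite !(intrD, intrM, mulrNz) /quartic !rmorphD /= !map_polyZ !map_polyXn map_polyX.
rewrite map_polyC !hornerE /=; ring.
Qed.

(** In each family [c2 + 2 * a] and [c1 - a] are constant, so the value depends on the parameter
    only through the multiple of t (t - 1)^2. Two tests suffice: positivity at parameter [m], and a
    nonpositive value at t = -1 for parameter [m + 1]. *)
Lemma positive_quarticP (R : realType) (a c1 c2 m : int) :
  CS_poly 4 (quartic 1 c1 c2 a) ->
  (forall t : R, t < 0 ->
     0 < t ^+ 4 + (c2 + 2 * a)%:~R * t ^+ 2 + (c1 - a)%:~R * t + 1
         + m%:~R * (t * (t - 1) ^+ 2)) ->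
  2 + (c2 + 2 * a) - (c1 - a) - 4 * (m + 1) <= 0 ->
  positive_CS_poly R 4 (quartic 1 c1 c2 a) <-> a <= m.
Proof.
move=> cs pos neg; split=> [[_ p] | le_am].
  have := p (-1) ltac:(lra); rewrite horner_quartic.
  rewrite (_ : _ + _ = (1 + (c2 + 2 * a) - (c1 - a) + 1 - 4 * a)%:~R); last first.
    by rewrite !(rmorphD, rmorphN, rmorphM) /=; ring.
  by rewrite ltr0z; lia.
split=> // t t0; rewrite horner_quartic; apply: lt_le_trans (pos t t0) _.
(* For t < 0 the factor t (t - 1)^2 is nonpositive, so passing from [m] down to [a] cannot lower the
   value. *)
rewrite lerD2l -subr_ge0 -mulrBl mulr_le0 ?subr_le0 ?ler_int //.
by rewrite nmulr_rle0 ?sqr_ge0.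
Qed.

Theorem theorem4p1 (R : realType) :
  (forall c0 c1 c2 c3 : int,
     CS_poly 4 (quartic c0 c1 c2 c3) <->
     exists a : int,
       [\/ (c0, c1, c2, c3) = (1, a - 1, - 2 * a, a),
           (c0, c1, c2, c3) = (1, a - 1, - 2 * a - 2, a),
           (c0, c1, c2, c3) = (1, a + 1, - 2 * a - 2, a)
         | (c0, c1, c2, c3) = (1, a + 1, - 2 * a - 4, a)]) /\
  (forall a : int,
     [/\ positive_CS_poly R 4 (quartic 1 (a - 1) (- 2 * a) a) <-> a <= 0,
         positive_CS_poly R 4 (quartic 1 (a - 1) (- 2 * a - 2) a) <-> a <= 0,
         positive_CS_poly R 4 (quartic 1 (a + 1) (- 2 * a - 2) a) <-> a <= -1
       & positive_CS_poly R 4 (quartic 1 (a + 1) (- 2 * a - 4) a) <-> a <= -1]).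
Proof.
split=> [|a]; first exact: CS_poly4_families.
(* At the extremal parameter the four quartics are t^4 - t + 1, (t^2 - 1)^2 - t, t^4 - t^3 + 1 and
   (t^2 - 1)^2 - t^3. These sign facts make each of them positive for t < 0 by linear reasoning. *)
have quad0 (t : R) : 0 <= (t ^+ 2 - 1) ^+ 2 by exact: sqr_ge0.
have pow4 (t : R) : 0 <= t ^+ 4 by rewrite exprn_even_ge0.
have pow3 (t : R) : t < 0 -> t ^+ 3 < 0 by move=> t0; rewrite exprn_odd_lt0.
split; apply: positive_quarticP; try lia;
  try (by apply/CS_poly4_families; exists a;
       do [exact: Or41 | exact: Or42 | exact: Or43 | exact: Or44]);
  move=> t t0; have := quad0 t; have := pow4 t; have := pow3 t t0.
- have -> : - 2 * a + 2 * a = 0 by lia.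
  have -> : a - 1 - a = -1 by lia.
  rewrite ?rmorphN /=; lra.
- have -> : - 2 * a - 2 + 2 * a = -2 by lia.
  have -> : a - 1 - a = -1 by lia.
  rewrite ?rmorphN /=; lra.
- have -> : - 2 * a - 2 + 2 * a = -2 by lia.
  have -> : a + 1 - a = 1 by lia.
  rewrite ?rmorphN /=; lra.
- have -> : - 2 * a - 4 + 2 * a = -4 by lia.
  have -> : a + 1 - a = 1 by lia.
  rewrite ?rmorphN /=; lra.
Qed.
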